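(* Let $G$ be a simple graph with no isolated vertex. If $G$ is a class I graph and $E(G)$ can be partitioned into maximum matchings of $G$, then $E(G)$ has a partition into (edge sets of) subgraphs of $G$, each of which is either isomorphic to $K_{1,\Delta(G)}$ or is a factor-critical graph $H$ such that $E(H)$ can also be partitioned into maximum matchings of $H$ and $\chi'(H)=\chi'(G)$.
   Context: All graphs are finite. A simple graph has no loops and no multiple edges. $E(G)$ is the edge set of $G$, $V(G)$ the vertex set, $\Delta(G)$ is the maximum degree of a vertex of $G$, and $\chi'(G)$ is the edge chromatic index (the least number of colors in a proper edge coloring). By Vizing's theorem, $\Delta(G)\le\chi'(G)\leq\Delta(G)+1$ for a simple graph; $G$ is in class I if $\chi'(G)=\Delta(G)$ and in class II if $\chi'(G)=\Delta(G)+1$. A maximum matching of a graph is a matching of largest possible size in that graph. For a vertex $x$, $G\setminus x$ denotes the subgraph induced on $V(G)\setminus\{x\}$. A simple, connected graph $H$ is called factor-critical if and only if $H\setminus x$ has a perfect matching for all $x\in V(H)$. *)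

(* Defs.v *)
From mathcomp Require Import all_boot.

Set Implicit Arguments.
Unset Strict Implicit.
Unset Printing Implicit Defensive.

(* Vertices live in an ambient finite type and edges are two-element sets of
   vertices, so that a graph and its subgraphs (whose vertex sets may be
   smaller) have the same type. *)
Record sgraph (T : finType) := SGraph {
  vset : {set T};
  eset : {set {set T}};
  _ : [forall f in eset, (#|f| == 2) && (f \subset vset)]
}.

Section Graphs.
Variable T : finType.
Implicit Types (G H : sgraph T) (M : {set {set T}}) (x y : T) (S : {set T}).

Lemma esetP G : [forall f in eset G, (#|f| == 2) && (f \subset vset G)].
Proof. by case: G. Qed.

Definition adj G : rel T := fun x y => [set x; y] \in eset G.

Definition subgraph H G : bool :=
  (vset H \subset vset G) && (eset H \subset eset G).

Lemma induced_proof G S :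
  [forall f in [set f in eset G | f \subset S],
     (#|f| == 2) && (f \subset vset G :&: S)].
Proof.
apply/forall_inP => f; rewrite inE => /andP[fG fS].
by have /forall_inP/(_ f fG)/andP[-> fV] := esetP G; rewrite subsetI fV fS.
Qed.

Definition induced G S : sgraph T := SGraph (induced_proof G S).

Definition del_vertex G x : sgraph T := induced G (vset G :\ x).

Definition degree G x : nat := #|[set f in eset G | x \in f]|.

Definition isolated G x : bool := (x \in vset G) && (degree G x == 0).

Definition max_degree G : nat := \max_(x in vset G) degree G x.

Definition matching G M : bool := (M \subset eset G) && trivIset M.

Definition maximum_matching G M : bool :=
  matching G M && [forall M' : {set {set T}}, matching G M' ==> (#|M'| <= #|M|)].

Definition perfect_matching G M : bool := matching G M && (cover M == vset G).

Definition partitioned_into_maximum_matchings G : Prop :=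
  exists2 P : {set {set {set T}}},
    partition P (eset G) & forall M, M \in P -> maximum_matching G M.

(* Colours are assigned to actual edges only; a colouring of all of {set T}
   would force an edgeless graph to use at least one colour. *)
Definition edge G : finType := {f : {set T} | f \in eset G}.

Definition proper_edge_coloring G (k : nat) (c : {ffun edge G -> 'I_k}) : bool :=
  [forall f : edge G, forall g : edge G,
     (f != g) && ~~ [disjoint val f & val g] ==> (c f != c g)].

Definition edge_colorable G (k : nat) : bool :=
  [exists c : {ffun edge G -> 'I_k}, proper_edge_coloring c].

Lemma edge_colorable_ex G : exists k, edge_colorable G k.
Proof.
exists #|edge G|; apply/existsP; exists [ffun f => enum_rank f].
apply/forallP => f; apply/forallP => g; apply/implyP => /andP[fg _].
by rewrite !ffunE (inj_eq enum_rank_inj).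
Qed.

Definition chromatic_index G : nat := ex_minn (edge_colorable_ex G).

Definition class_I G : bool := chromatic_index G == max_degree G.

(* The graph without vertices is not connected. *)
Definition connected G : bool :=
  (vset G != set0) &&
  [forall x in vset G, forall y in vset G, connect (adj G) x y].

Definition factor_critical G : bool :=
  connected G &&
  [forall x in vset G, exists M : {set {set T}},
     perfect_matching (del_vertex G x) M].

End Graphs.

Definition isomorphic (T U : finType) (G : sgraph T) (H : sgraph U) : Prop :=
  exists2 h : {x : T | x \in vset G} -> {y : U | y \in vset H},
    bijective h &
    forall x y, adj H (val (h x)) (val (h y)) = adj G (val x) (val y).

Lemma complete_bipartite_proof (m n : nat) :
  [forall f in [set [set inl i; inr j] | i : 'I_m, j : 'I_n],
     (#|f : {set 'I_m + 'I_n}| == 2) && (f \subset [set: 'I_m + 'I_n])].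
Proof.
by apply/forall_inP => f /imset2P[i j _ _ ->]; rewrite cards2 subsetT.
Qed.

Definition complete_bipartite (m n : nat) : sgraph ('I_m + 'I_n)%type :=
  SGraph (complete_bipartite_proof m n).

(* Main.v *)
Require Import Defs.
From mathcomp Require Import all_boot.

(** Since all maximum matchings have the same size, a partition of E(G) into
k of them is an optimal proper colouring, so k is the chromatic index; class I
makes it Delta(G) as well. Fix this colouring c. The invariant is that every
colour class is a maximum matching of the current graph
([maximum_coloring]), and one block of edges at a time is removed without
losing it.

If some vertex v is covered by every maximum matching, then every colour
appears at v, so v has degree k and its edges form a K_{1,k}. Deleting them
lowers the matching number by one and removes exactly one edge of each colour,
so the invariant survives ([peel_star]).

Otherwise every vertex is missed by some maximum matching. Gallai's lemma then
says that every connected component is factor-critical. Its heart is that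
being inseparable (no maximum matching misses both vertices) is transitive
through a vertex that can be missed ([inseparable_trans]); adjacent vertices
are inseparable, hence so are all vertices of a component. Maximum matchings
restrict to maximum matchings on a union of components, so both a
component and the rest of the graph inherit the colouring with all k colours
([peel_component]). Each such component has chromatic index k by the counting
argument of the first paragraph ([maximum_coloring_chromatic_index]). *)

Set Implicit Arguments.
Unset Strict Implicit.
Unset Printing Implicit Defensive.

Section Decomposition.
Variable T : finType.
Implicit Types (G H : sgraph T) (M N B : {set {set T}}) (f g : {set T}).
Implicit Types (u v x y t : T).

(** * Edges and matchings *)

Lemma edge_card G f : f \in eset G -> #|f| = 2.
Proof. by move=> fG; have /forall_inP/(_ f fG)/andP[/eqP] := esetP G. Qed.

Lemma edge_sub G f : f \in eset G -> f \subset vset G.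
Proof. by move=> fG; have /forall_inP/(_ f fG)/andP[] := esetP G. Qed.

Lemma edge_other_end G f x : f \in eset G -> x \in f ->
  exists2 y, y != x & f = [set x; y].
Proof.
move=> /edge_card /eqP/cards2P[a [b [ab ->]]]; rewrite !inE => /orP[]/eqP->.
  by exists b; rewrite // eq_sym.
by exists a; rewrite // setUC.
Qed.

Lemma adj_sym G : symmetric (adj G).
Proof. by move=> x y; rewrite /adj setUC. Qed.

Lemma cover_edge M f x : f \in M -> x \in f -> x \in cover M.
Proof. by move=> fM xf; apply/bigcupP; exists f. Qed.

Lemma matching_unique G M f g x : matching G M ->
  f \in M -> g \in M -> x \in f -> x \in g -> f = g.
Proof.
move=> /andP[_ /trivIsetP tM] fM gM xf xg; apply/eqP; apply: contraT => fg.
by have /pred0P/(_ x) := tM f g fM gM fg; rewrite /= xf xg.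
Qed.

Lemma matching_cover_card G M : matching G M -> #|cover M| = 2 * #|M|.
Proof.
move=> /andP[/subsetP MG /eqP <-].
rewrite mulnC -sum_nat_const; apply: eq_bigr => f fM.
exact: edge_card (MG f fM).
Qed.

Lemma sub_matching G M N : M \subset N -> matching G N -> matching G M.
Proof.
move=> MN /andP[NG tN].
by rewrite /matching (subset_trans MN NG) (trivIsetS MN tN).
Qed.

Lemma matchingU G M N : matching G M -> matching G N ->
  [disjoint cover M & cover N] -> matching G (M :|: N).
Proof.
move=> /andP[MG tM] /andP[NG tN] dMN.
by rewrite /matching subUset MG NG trivIsetU.
Qed.

Lemma matching1 G f : f \in eset G -> matching G [set f].
Proof.
move=> fG; rewrite /matching sub1set fG /=.
by apply/trivIsetP => a b /set1P-> /set1P->; rewrite eqxx.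
Qed.

Lemma maximum_matching_matching G M : maximum_matching G M -> matching G M.
Proof. by case/andP. Qed.

Lemma maximum_matching_max G M N :
  maximum_matching G M -> matching G N -> #|N| <= #|M|.
Proof. by move=> /andP[_ /forall_inP]; apply. Qed.

Lemma maximum_matching_card G M N :
  maximum_matching G M -> maximum_matching G N -> #|M| = #|N|.
Proof.
move=> maxM maxN; apply/eqP; rewrite eqn_leq.
by rewrite (maximum_matching_max maxN) ?(maximum_matching_max maxM) //
           maximum_matching_matching.
Qed.

Lemma large_matching_maximum G M N : maximum_matching G M ->
  matching G N -> #|M| <= #|N| -> maximum_matching G N.
Proof.
move=> maxM matN MN; rewrite /maximum_matching matN; apply/forall_inP => K matK.
exact: leq_trans (maximum_matching_max maxM matK) MN.
Qed.

(** Otherwise the edge could be added to the matching. *)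
Lemma maximum_matching_meets_edge G M x y : maximum_matching G M ->
  [set x; y] \in eset G -> (x \in cover M) || (y \in cover M).
Proof.
move=> maxM xyG; apply: contraT; rewrite negb_or => /andP[xM yM].
have dM : [disjoint cover [set [set x; y]] & cover M].
  by rewrite cover1 disjoints_subset; apply/subsetP => z;
    rewrite !inE => /orP[]/eqP->.
have fM : [set x; y] \notin M.
  by apply: contra xM => /cover_edge; apply; rewrite !inE eqxx.
have := maximum_matching_max maxM
  (matchingU (matching1 xyG) (maximum_matching_matching maxM) dM).
by rewrite cardsU1 fM ltnn.
Qed.

(** * Gallai's lemma *)

Definition missable G x :=
  exists2 M, maximum_matching G M & x \notin cover M.

Definition inseparable G u v := forall M, maximum_matching G M ->
  u != v -> (u \in cover M) || (v \in cover M).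

(** An exchange argument. Suppose that a maximum matching M misses u and v, and
choose N, among the maximum matchings missing t, with the largest intersection
with M. Inseparability forces N to cover u and v and M to cover t; as M and N
cover equally many vertices, M covers some x other than t that N misses. If
xy is the edge of M at x, replacing the edge of N at y by xy turns N into a
maximum matching that still misses t and has one more edge in common with M. *)
Lemma inseparable_trans G t u v : missable G t ->
  inseparable G u t -> inseparable G t v -> inseparable G u v.
Proof.
move=> [N0 maxN0 tN0] ut tv M maxM uv.
apply: contraT; rewrite negb_or => /andP[uM vM].
have u't : u != t.
  by apply: contraNneq vM => ut'; have := tv M maxM; rewrite -ut' (negPf uM) uv;
     exact.
have t'v : t != v.
  by apply: contraNneq uM => tv'; have := ut M maxM;
     rewrite tv' (negPf vM) orbF; exact.
have tM : t \in cover M by have := ut M maxM u't; rewrite (negPf uM).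
have PN0 : maximum_matching G N0 && (t \notin cover N0) by rewrite maxN0.
case: (@arg_maxnP _ N0 (fun N => maximum_matching G N && (t \notin cover N))
  (fun N => #|M :&: N|) PN0) => N /andP[maxN tN] bestN.
have matM := maximum_matching_matching maxM.
have matN := maximum_matching_matching maxN.
have uN : u \in cover N by have := ut N maxN u't; rewrite (negPf tN) orbF.
have vN : v \in cover N by have := tv N maxN t'v; rewrite (negPf tN).
(* The covers of M and N differ equally in both directions, and u, v are two
   vertices of cover N outside cover M. *)
have [x /and3P[xM xN xt]] :
  exists x, [&& x \in cover M, x \notin cover N & x != t].
  have cMN : #|cover M :\: cover N| = #|cover N :\: cover M|.
    rewrite !cardsD [cover N :&: _]setIC !(@matching_cover_card G) //.
    by rewrite (maximum_matching_card maxM maxN).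
  have : 1 < #|cover M :\: cover N|.
    rewrite cMN; apply: leq_trans (subset_leq_card (_ : [set u; v] \subset _)).
      by rewrite cards2 uv.
    by apply/subsetP => z; rewrite !inE => /orP[]/eqP->;
       rewrite ?uM ?vM ?uN ?vN.
  rewrite (cardsD1 t) !inE tM tN ltnS card_gt0 => /set0Pn[x].
  by rewrite !inE => /and3P[xt xN xM]; exists x; rewrite xM xN xt.
have /bigcupP[f fM xf] := xM.
have fG : f \in eset G by case/andP: matM => /subsetP/(_ f fM).
have [y yx fE] := edge_other_end fG xf.
have yN : y \in cover N.
  have := maximum_matching_meets_edge (x := x) (y := y) maxN.
  by rewrite -fE fG (negPf xN); exact.
have /bigcupP[g gN yg] := yN.
have xg : x \notin g by apply: contra xN => /(cover_edge gN).
have gM : g \notin M.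
  apply: contra xg => gM; suff -> : g = f by [].
  by apply: (matching_unique matM gM fM yg); rewrite fE !inE eqxx orbT.
have fN : f \notin N by apply: contra xN => /cover_edge; apply.
have dfN : [disjoint cover [set f] & cover (N :\ g)].
  rewrite cover1 disjoints_subset fE; apply/subsetP => z; rewrite !inE.
  move=> zf; apply/bigcupP => -[h]; rewrite !inE => /andP[hg hN] zh.
  case/orP: zf => /eqP zE; rewrite zE in zh.
    by case/negP: xN; exact: cover_edge hN zh.
  by case/eqP: hg; exact: matching_unique matN hN gN zh yg.
have matN' : matching G (f |: (N :\ g)).
  apply: matchingU (matching1 fG) _ dfN.
  by apply: sub_matching matN; exact: subsetDl.
have maxN' : maximum_matching G (f |: (N :\ g)).
  apply: (large_matching_maximum maxN matN').
  by rewrite cardsU1 !inE (negPf fN) andbF add1n (cardsD1 g N) gN.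
have tN' : t \notin cover (f |: (N :\ g)).
  apply/bigcupP => -[h]; rewrite !inE => /orP[/eqP->|/andP[_ hN] th].
    rewrite fE !inE eq_sym (negPf xt) => /eqP tE.
    by rewrite tE yN in tN.
  by case/negP: tN; exact: cover_edge hN th.
(* The new matching shares f with M in addition to all of M :&: N. *)
have := bestN (f |: (N :\ g)); rewrite maxN' tN' => /(_ isT).
suff -> : M :&: (f |: N :\ g) = f |: (M :&: N).
  by rewrite /geq /= cardsU1 !inE (negPf fN) andbF ltnn.
apply/setP => h; rewrite !inE; case: (h =P f) => [->|_] /=; first by rewrite fM.
by case: (h =P g) => [->|_] //=; rewrite (negPf gM).
Qed.

(** Gallai's lemma in disguise: a maximum matching misses at most one vertex
of each component. Adjacent vertices are inseparable, and transitivity carries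
this along a path because all its vertices can be missed. *)
Lemma connected_inseparable G u v : (forall x, missable G x) ->
  connect (adj G) u v -> inseparable G u v.
Proof.
move=> miss /connectP[p]; elim: p u => [|w p IHp] u /=.
  by move=> _ -> M _; rewrite eqxx.
move=> /andP[uw pw] vE; apply: inseparable_trans (miss w) _ (IHp w pw vE).
by move=> M maxM _; exact: maximum_matching_meets_edge maxM uw.
Qed.

(** * Restricting maximum matchings to sets of edges *)

Lemma edge_subgraph_proof G B :
  [forall f in eset G :&: B, (#|f| == 2) && (f \subset cover (eset G :&: B))].
Proof.
apply/forall_inP => f fGB; rewrite (@edge_card G) ?eqxx //=.
  by apply/subsetP => x; exact: cover_edge.
by case/setIP: fGB.
Qed.

(** Only the ends of the chosen edges are vertices, so that no isolated vertex
spoils connectedness or the shape of a star. *)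
Definition edge_subgraph G B : sgraph T := SGraph (edge_subgraph_proof G B).

Lemma edge_subgraph_subgraph G B : subgraph (edge_subgraph G B) G.
Proof.
rewrite /subgraph subsetIl andbT; apply/bigcupsP => f /setIP[fG _].
exact: edge_sub.
Qed.

Lemma subgraph_trans G1 G2 G3 :
  subgraph G1 G2 -> subgraph G2 G3 -> subgraph G1 G3.
Proof.
move=> /andP[V12 E12] /andP[V23 E23].
by rewrite /subgraph (subset_trans V12) ?(subset_trans E12).
Qed.

Lemma matching_edge_subgraph G B M :
  matching (edge_subgraph G B) M = matching G M && (M \subset B).
Proof. by rewrite /matching subsetI andbAC. Qed.

(** B is a union of components: no edge inside B touches one outside. A larger
matching inside B could replace M :&: B and enlarge M. *)
Lemma maximum_matching_component G B M :
  {in eset G &, forall f g, f \in B -> g \notin B -> [disjoint f & g]} ->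
  maximum_matching G M -> maximum_matching (edge_subgraph G B) (M :&: B).
Proof.
move=> disB maxM; have matM := maximum_matching_matching maxM.
have matMB := sub_matching (subsetIl M B) matM.
rewrite /maximum_matching matching_edge_subgraph matMB subsetIr /=.
apply/forall_inP => N; rewrite matching_edge_subgraph => /andP[matN NB].
have dN : [disjoint cover N & cover (M :\: B)].
  rewrite disjoints_subset; apply/subsetP => x /bigcupP[f fN xf]; rewrite inE.
  apply/bigcupP => -[g /setDP[gM gB] xg].
  case/andP: matM => /subsetP/(_ g gM) gG _.
  case/andP: matN => /subsetP/(_ f fN) fG _.
  have /pred0P/(_ x) := disB f g fG gG (subsetP NB f fN) gB.
  by rewrite /= xf xg.
have := maximum_matching_max maxM
  (matchingU matN (sub_matching (subsetDl M B) matM) dN).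
rewrite cardsU (_ : N :&: (M :\: B) = set0) ?cards0 ?subn0.
  by rewrite -(cardsID B M) leq_add2r.
apply/setP => f; rewrite !inE; case fN: (f \in N) => //=.
by rewrite (subsetP NB f fN).
Qed.

Definition edges_at v : {set {set T}} := [set f : {set T} | v \in f].

(** M loses exactly one edge. A matching of the remainder of size at least #|M|
would be a maximum matching of G missing v. *)
Lemma maximum_matching_del_essential G v M :
  (forall N, maximum_matching G N -> v \in cover N) ->
  maximum_matching G M ->
  maximum_matching (edge_subgraph G (~: edges_at v)) (M :&: ~: edges_at v).
Proof.
move=> ess maxM; have matM := maximum_matching_matching maxM.
have matMB := sub_matching (subsetIl M (~: edges_at v)) matM.
rewrite /maximum_matching matching_edge_subgraph matMB subsetIr /=.
apply/forall_inP => N; rewrite matching_edge_subgraph.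
move=> /andP[matN /subsetP Nv].
rewrite leqNgt; apply/negP => ltN.
have /bigcupP[f fM vf] := ess M maxM.
have MfE : M :\ f \subset M :&: (~: edges_at v).
  apply/subsetP => g; rewrite !inE => /andP[gf gM]; rewrite gM /=.
  by apply: contra gf => vg; rewrite (matching_unique matM gM fM vg vf).
have leMN : #|M| <= #|N|.
  by rewrite (cardsD1 f M) fM; apply: leq_ltn_trans ltN; exact: subset_leq_card.
have /bigcupP[g gN vg] := ess N (large_matching_maximum maxM matN leMN).
by have := Nv g gN; rewrite !inE vg.
Qed.

Lemma card_fibers (U : finType) (k : nat) (h : U -> 'I_k) (A : {set U}) :
  #|A| = \sum_(i < k) #|[set a in A | h a == i]|.
Proof.
rewrite -sum1_card (partition_big h predT) //=; apply: eq_bigr => i _.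
by rewrite -sum1_card; apply: eq_bigl => a; rewrite inE.
Qed.

(** * Colourings whose classes are maximum matchings *)

Section Coloring.
Variables (k : nat) (c : {set T} -> 'I_k).

Definition color_class G i := [set f in eset G | c f == i].

Definition maximum_coloring G := forall i, maximum_matching G (color_class G i).

Lemma color_class_edge_subgraph G B i :
  color_class (edge_subgraph G B) i = color_class G i :&: B.
Proof. by apply/setP => f; rewrite !inE andbAC. Qed.

Lemma maximum_coloring_partition G : maximum_coloring G ->
  partitioned_into_maximum_matchings G.
Proof.
move=> colG; exists (preim_partition c (eset G)); first exact: preim_partitionP.
move=> M /imsetP[f fG ->].
rewrite [X in maximum_matching _ X](_ : _ = color_class G (c f)) //.
by apply/setP => g; rewrite !inE eq_sym.
Qed.

(** The k classes all have the same size nu > 0, so G has k * nu edges, while a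
proper colouring with m colours has classes of size at most nu, hence accounts
for at most m * nu edges. *)
Lemma maximum_coloring_chromatic_index G : maximum_coloring G ->
  eset G != set0 -> chromatic_index G = k.
Proof.
move=> colG /set0Pn[f0 f0G]; pose nu := #|color_class G (c f0)|.
have nu_gt0 : 0 < nu by apply/card_gt0P; exists f0; rewrite inE f0G eqxx.
have cardG : #|eset G| = k * nu.
  rewrite (card_fibers c) (eq_bigr (fun=> nu)) => [|i _].
    by rewrite sum_nat_const card_ord.
  exact: maximum_matching_card (colG i) (colG (c f0)).
rewrite /chromatic_index; case: ex_minnP.
move=> m /existsP[d /forallP d_proper] minm.
apply/eqP; rewrite eqn_leq; apply/andP; split.
  apply: minm; apply/existsP; exists [ffun f => c (val f)].
  apply/forallP => f; apply/forallP => g; apply/implyP => /andP[fg].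
  rewrite !ffunE; apply: contra => /eqP cfg.
  have /maximum_matching_matching/andP[_ /trivIsetP triv] := colG (c (val f)).
  by apply: triv; rewrite ?inE ?(valP f) ?(valP g) ?cfg ?eqxx ?(inj_eq val_inj).
rewrite -(leq_pmul2r nu_gt0) -cardG -(card_sig (mem (eset G))) -cardsT.
rewrite (card_fibers d) -[X in _ <= X * _]card_ord -sum_nat_const.
apply: leq_sum => i _.
rewrite -(card_imset _ val_inj); apply: maximum_matching_max (colG _) _.
apply/andP; split; first by apply/subsetP => _ /imsetP[f _ ->]; exact: valP f.
apply/trivIsetP => _ _ /imsetP[f fi ->] /imsetP[g gi ->] fg.
move: fi gi; rewrite !inE => /eqP fi /eqP gi.
have /forallP/(_ g) := d_proper f; rewrite fi gi eqxx implybF negb_and negbK.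
by rewrite -(inj_eq val_inj) (negPf fg) negbK.
Qed.

(** The colouring itself supplies the isomorphism: the leaf at the end of the
edge of colour i goes to the i-th vertex of the large side. *)
Lemma rainbow_star_isomorphic H v : 0 < k -> vset H = cover (eset H) ->
  (forall f, f \in eset H -> v \in f) -> {in eset H &, injective c} ->
  (forall i, exists2 f, f \in eset H & c f = i) ->
  isomorphic H (complete_bipartite 1 k).
Proof.
move=> k_gt0 vH atv c_inj c_surj.
pose s x : 'I_1 + 'I_k := if x == v then inl ord0 else inr (c [set v; x]).
have star_edge x : x \in vset H -> x != v -> [set v; x] \in eset H.
  rewrite vH => /bigcupP[f fH xf] xv.
  have [y yv fE] := edge_other_end fH (atv f fH).
  by move: xf fH; rewrite fE !inE (negPf xv) => /eqP->.
have vvH : [set v; v] \notin eset H.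
  by apply/negP => /edge_card; rewrite cards2 eqxx.
have s_inj : {in vset H &, injective s}.
  move=> x y xH yH; rewrite /s.
  case: eqP => [->|/eqP xv]; case: eqP => [->|/eqP yv] //.
  case=> /(c_inj _ _ (star_edge x xH xv) (star_edge y yH yv))/setP/(_ x).
  by rewrite !inE eqxx orbT (negPf xv) => /esym/eqP.
have s_surj w : exists2 x, x \in vset H & s x = w.
  case: w => [j|i].
    have [f fH _] := c_surj (Ordinal k_gt0); exists v.
      by rewrite vH; exact: cover_edge fH (atv f fH).
    by rewrite /s eqxx (ord1 j).
  have [f fH cf] := c_surj i; have [x xv fE] := edge_other_end fH (atv f fH).
  exists x; last by rewrite /s (negPf xv) -fE cf.
  by rewrite vH; apply: cover_edge fH _; rewrite fE !inE eqxx orbT.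
pose h (x : {x : T | x \in vset H}) :
    {w | w \in vset (complete_bipartite 1 k)} :=
  exist _ (s (val x)) (in_setT (s (val x))).
exists h.
  apply: inj_card_bij.
    by move=> x y [] /s_inj => /(_ (valP x) (valP y)); exact: val_inj.
  apply: leq_trans (leq_image_card h predT); apply: subset_leq_card.
  apply/subsetP => w _; have [x xH sx] := s_surj (val w).
  apply/imageP; exists (exist _ x xH) => //; exact: val_inj.
move=> [x xH] [y yH]; rewrite /h /= /adj /s.
case: eqP => [->|/eqP xv]; case: eqP => [->|/eqP yv].
- rewrite (negPf vvH); apply/imset2P => -[i j _ _ /setP/(_ (inr j))].
  by rewrite !inE eqxx.
- by rewrite star_edge //; apply/imset2P; exists ord0 (c [set v; y]).
- rewrite [[set x; v]]setUC star_edge // setUC.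
  by apply/imset2P; exists ord0 (c [set v; x]).
transitivity false; last first.
  apply/esym/negbTE/negP => /atv; rewrite !inE => /orP[]/eqP vE.
    by rewrite vE eqxx in xv.
  by rewrite vE eqxx in yv.
apply/imset2P => -[i j _ _ /setP/(_ (inl i))].
by rewrite !inE eqxx.
Qed.

(** * Peeling off stars and factor-critical components *)

(** Every colour class covers v and is a matching, so the edges at v realize
each colour exactly once. *)
Lemma peel_star G v : 0 < k -> maximum_coloring G ->
  (forall M, maximum_matching G M -> v \in cover M) ->
  [/\ maximum_coloring (edge_subgraph G (~: edges_at v)),
      eset (edge_subgraph G (edges_at v)) != set0
    & isomorphic (edge_subgraph G (edges_at v)) (complete_bipartite 1 k)].
Proof.
move=> k_gt0 colG ess.
have c_surj i : exists2 f, f \in eset (edge_subgraph G (edges_at v)) & c f = i.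
  have /bigcupP[f] := ess _ (colG i); rewrite inE => /andP[fG /eqP cf] vf.
  by exists f; rewrite // !inE fG.
split.
- move=> i; rewrite color_class_edge_subgraph.
  exact: maximum_matching_del_essential.
- have [f fH _] := c_surj (Ordinal k_gt0).
  by apply/set0Pn; exists f.
apply: (@rainbow_star_isomorphic _ v) => //.
  by move=> f; rewrite !inE => /andP[].
move=> f g; rewrite !inE => /andP[fG vf] /andP[gG vg] cfg.
apply: (matching_unique (maximum_matching_matching (colG (c f))) _ _ vf vg).
  by rewrite inE fG eqxx.
by rewrite inE gG cfg eqxx.
Qed.

(** B consists of the edges of the component of one end of f. A maximum matching
of G missing y covers all other vertices of the component of y, by
inseparability, and its edges inside the component form the perfect matching
required after deleting y. *)
Lemma peel_component G f : maximum_coloring G -> (forall x, missable G x) ->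
  f \in eset G ->
  exists B, let H := edge_subgraph G B in
    [/\ maximum_coloring (edge_subgraph G (~: B)), maximum_coloring H,
        eset H != set0 & factor_critical H].
Proof.
move=> colG miss fG.
have /card_gt0P[x xf] : 0 < #|f| by rewrite (edge_card fG).
pose S := [set y | connect (adj G) x y].
pose B := [set g : {set T} | g \subset S].
have csym := sym_connect_sym (@adj_sym G).
have edge_in_S g z : g \in eset G -> z \in g -> z \in S -> g \in B.
  move=> gG zg; rewrite !inE => xz; have [w _ gE] := edge_other_end gG zg.
  apply/subsetP => y; rewrite gE !inE => /orP[]/eqP-> //.
  by apply: connect_trans xz (connect1 _); rewrite /adj -gE.
have disB : {in eset G &,
    forall g h, g \in B -> h \notin B -> [disjoint g & h]}.
  move=> g h gG hG; rewrite inE => /subsetP gS hB; apply/pred0P => z /=.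
  by apply: contraNF hB => /andP[/gS zS zh]; exact: edge_in_S hG zh zS.
exists B => H.
have vHS z : z \in vset H -> z \in S.
  by case/bigcupP => g /setIP[_]; rewrite inE => /subsetP gS /gS.
have vH_edge g z : g \in eset G -> z \in g -> z \in vset H -> g \in eset H.
  by move=> gG zg /vHS zS; rewrite inE gG (edge_in_S _ _ gG zg zS).
have fH : f \in eset H.
  by rewrite inE fG (edge_in_S _ _ fG xf) // inE connect0.
have xH : x \in vset H by exact: cover_edge fH xf.
have vH_connect y z : y \in vset H -> z \in vset H -> connect (adj G) y z.
  by move=> /vHS + /vHS; rewrite !inE csym; exact: connect_trans.
split.
- move=> i; rewrite color_class_edge_subgraph.
  apply: maximum_matching_component => //.
  move=> g h gG hG; rewrite !inE negbK disjoint_sym => gB hB.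
  by apply: disB; rewrite ?inE.
- move=> i; rewrite color_class_edge_subgraph.
  exact: maximum_matching_component.
- by apply/set0Pn; exists f.
apply/andP; split.
  apply/andP; split; first by apply/set0Pn; exists x.
  apply/forall_inP => y yH; apply/forall_inP => z zH.
  (* A path of G from y cannot leave H; connectivity is transferred by showing
     that what H reaches from y is closed under adjacency in G. *)
  pose R := [pred w | (w \in vset H) && connect (adj H) y w].
  suff /closed_connect/(_ _ _ (vH_connect y z yH zH)) : closed (adj G) R.
    by rewrite !inE yH connect0 => /esym/andP[].
  apply: (intro_closed csym) => u w uw; rewrite !inE => /andP[uH yu].
  have uwH : [set u; w] \in eset H by apply: vH_edge uw _ uH; rewrite !inE eqxx.
  rewrite (cover_edge uwH) ?inE ?eqxx ?orbT //=.
  exact: connect_trans yu (connect1 uwH).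
apply/forall_inP => y yH; have [N maxN yN] := miss y.
have matN := maximum_matching_matching maxN.
have NG g : g \in N -> g \in eset G by case/andP: matN => /subsetP NG _ /NG.
apply/existsP; exists (N :&: eset H); apply/andP; split.
  apply/andP; split; last by case/andP: matN => _; exact/trivIsetS/subsetIl.
  apply/subsetP => g /setIP[gN gH]; rewrite inE gH subsetD1 (edge_sub gH) /=.
  by apply: contra yN; exact: cover_edge.
rewrite eqEsubset; apply/andP; split.
  apply/bigcupsP => g /setIP[gN gH]; rewrite subsetI subsetD1 (edge_sub gH) /=.
  by apply: contra yN; exact: cover_edge.
apply/subsetP => z; rewrite /= !in_setI in_setD1 => /and3P[zH zy _].
have := connected_inseparable miss (vH_connect y z yH zH) maxN.
rewrite eq_sym zy (negPf yN) => /(_ isT) /bigcupP[g gN zg].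
apply: (cover_edge (f := g)) => //; rewrite in_setI gN;
  exact: vH_edge (NG g gN) zg zH.
Qed.

Lemma star_critical_decomposition G : 0 < k -> maximum_coloring G ->
  exists2 P : {set {set {set T}}}, partition P (eset G) &
    forall B, B \in P -> exists H : sgraph T,
      [/\ subgraph H G, eset H = B &
          isomorphic H (complete_bipartite 1 k) \/
          [/\ factor_critical H, partitioned_into_maximum_matchings H &
              chromatic_index H = k]].
Proof.
move=> k_gt0; have [n] := ubnP #|eset G|; elim: n G => // n IHn G leGn colG.
have [G0|] := eqVneq (eset G) set0.
  by exists set0; [rewrite G0 partition_set0 | move=> B; rewrite inE].
move=> /set0Pn[f fG].
have [B [colGB HB0 HB]] : exists B,
    [/\ maximum_coloring (edge_subgraph G (~: B)),
        eset (edge_subgraph G B) != set0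
      & isomorphic (edge_subgraph G B) (complete_bipartite 1 k) \/
        [/\ factor_critical (edge_subgraph G B),
            partitioned_into_maximum_matchings (edge_subgraph G B) &
            chromatic_index (edge_subgraph G B) = k]].
  have [/existsP[v /forall_inP ess]|/existsPn miss] := boolP
      [exists v, forall (M | maximum_matching G M), v \in cover M].
    have [? ? ?] := peel_star k_gt0 colG ess.
    by exists (edges_at v); split=> //; left.
  have [|B [? colB ? ?]] := peel_component colG _ fG.
    move=> x; have := miss x; rewrite negb_forall_in => /exists_inP[M maxM xM].
    by exists M.
  exists B; split=> //; right; split=> //.
    exact: maximum_coloring_partition.
  exact: maximum_coloring_chromatic_index.
have EB : eset G = eset (edge_subgraph G B) :|: eset (edge_subgraph G (~: B)).
  by rewrite -setIUr setUCr setIT.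
have dB : [disjoint eset (edge_subgraph G B) & eset (edge_subgraph G (~: B))].
  by rewrite -setI_eq0 setIACA setICr setI0.
have [|P partP HP] := IHn (edge_subgraph G (~: B)) _ colGB.
  apply: (@leq_trans #|eset G|); last by [].
  by rewrite EB cardsU (disjoint_setI0 dB) cards0 subn0 -addn1 addnC leq_add2r
             card_gt0.
exists (eset (edge_subgraph G B) |: P); first by rewrite EB; exact: partitionU1.
move=> B' /setU1P[->|/HP[H [HG HB' Hprop]]].
  by exists (edge_subgraph G B); split=> //; exact: edge_subgraph_subgraph.
by exists H; split=> //; exact: subgraph_trans HG (edge_subgraph_subgraph _ _).
Qed.

End Coloring.

Lemma partition_maximum_coloring G : eset G != set0 ->
  partitioned_into_maximum_matchings G ->
  exists k (c : {set T} -> 'I_k), 0 < k /\ maximum_coloring c G.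
Proof.
move=> /set0Pn[f0 f0G] [P partP maxP].
have /and3P[/eqP covP trivP _] := partP.
have pblockP f : f \in eset G -> pblock P f \in P.
  by rewrite -covP; exact: pblock_mem.
exists #|P|, (fun f => enum_rank_in (pblockP f0 f0G) (pblock P f)).
split; first by apply/card_gt0P; exists (pblock P f0); exact: pblockP.
move=> i; rewrite (_ : color_class _ _ _ = enum_val i).
  exact/maxP/enum_valP.
apply/setP => f; rewrite inE; apply/andP/idP => [[fG /eqP <-]|fi].
  by rewrite enum_rankK_in ?pblockP // mem_pblock covP.
rewrite -covP; split.
  by apply/bigcupP; exists (enum_val i); rewrite ?enum_valP.
by rewrite (def_pblock trivP (enum_valP i) fi) enum_valK_in.
Qed.

End Decomposition.

Theorem theorem3 (T : finType) (G : sgraph T)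
    (noisolated : forall x : T, x \in vset G -> ~~ isolated G x)
    (classI : class_I G)
    (maxpart : partitioned_into_maximum_matchings G) :
  exists2 P : {set {set {set T}}},
    partition P (eset G) &
    forall B : {set {set T}}, B \in P ->
      exists H : sgraph T,
        [/\ subgraph H G, eset H = B &
            isomorphic H (complete_bipartite 1 (max_degree G)) \/
            [/\ factor_critical H,
                partitioned_into_maximum_matchings H &
                chromatic_index H = chromatic_index G]].
Proof.
have [G0|Gn0] := eqVneq (eset G) set0.
  by exists set0; [rewrite G0 partition_set0 | move=> B; rewrite inE].
have [k [c [k_gt0 colG]]] := partition_maximum_coloring Gn0 maxpart.
move/eqP: classI => <-; rewrite (maximum_coloring_chromatic_index colG Gn0).
exact: star_critical_decomposition colG.
Qed.
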